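(* Let $V:\mathbb{R}^n\to\mathbb{R}$ be $L$-smooth, let $\overline{\nabla}$ be a discrete gradient construction satisfying the Smoothness/Monotonicity Assumption stated in the context (with constants $c_L,c_\mu>0$), and put $L_{\mathrm{DG}}:=c_LL$ and $\mu_{\mathrm{DG}}:=c_\mu\mu$. Let $x\in\mathbb{R}^n$ and $\tau>0$, and define $$T_\tau(y):=x-\tau\overline{\nabla}V(x,y),\qquad S_{\theta,\tau}(y):=(1-\theta)y+\theta\,T_\tau(y),\qquad y\in\mathbb{R}^n.$$ Then $S_{\theta,\tau}$ is a contraction mapping on $\mathbb{R}^n$ if either of the following holds: (i) $\tau<1/L_{\mathrm{DG}}$ and $\theta\in(0,1]$; (ii) $V$ is $\mu$-convex and $\theta\in\left(0,\ \min\left\{1,\ \dfrac{2+2\tau\mu_{\mathrm{DG}}}{1+\tau^2L_{\mathrm{DG}}^2+2\tau\mu_{\mathrm{DG}}}\right\}\right)$.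
   Context: $\|\cdot\|$ and $\langle\cdot,\cdot\rangle$ are the Euclidean norm and inner product. A map $S:\mathbb{R}^n\to\mathbb{R}^n$ is a contraction mapping if there is $q\in[0,1)$ with $\|S(y)-S(z)\|\le q\|y-z\|$ for all $y,z$. $V$ is $L$-smooth ($L>0$) if $V$ is continuously differentiable and $\|\nabla V(x)-\nabla V(y)\|\le L\|x-y\|$ for all $x,y\in\mathbb{R}^n$. $V$ is $\mu$-convex ($\mu\ge0$) if $V(\cdot)-\frac{\mu}{2}\|\cdot\|^2$ is convex. Discrete gradient: for continuously differentiable $V:\mathbb{R}^n\to\mathbb{R}$, a continuous map $\overline{\nabla}V:\mathbb{R}^n\times\mathbb{R}^n\to\mathbb{R}^n$ with $\langle\overline{\nabla}V(x,y),y-x\rangle=V(y)-V(x)$ and $\overline{\nabla}V(x,x)=\nabla V(x)$ for all $x,y$. A discrete gradient construction $\overline{\nabla}$ assigns to each continuously differentiable $V$ a discrete gradient $\overline{\nabla}V$. Smoothness/Monotonicity Assumption on $\overline{\nabla}$: there are constants $c_L,c_\mu>0$ such that (a) if $V$ is $L$-smooth, then for all $x\in\mathbb{R}^n$ the map $y\mapsto\overline{\nabla}V(x,y)$ is $c_LL$-Lipschitz continuous; (b) if $V$ is $\mu$-convex, then $\langle\overline{\nabla}V(x,y)-\overline{\nabla}V(x,z),y-z\rangle\ge c_\mu\mu\|y-z\|^2$ for all $x,y,z\in\mathbb{R}^n$. *)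

(* Defs.v *)
From HB Require Import structures.
From mathcomp Require Import all_boot all_order all_algebra.
From mathcomp Require Import all_classical all_reals all_analysis.

Set Implicit Arguments.
Unset Strict Implicit.
Unset Printing Implicit Defensive.

Import Order.TTheory GRing.Theory Num.Theory.
Import numFieldNormedType.Exports.

Local Open Scope classical_set_scope.
Local Open Scope ring_scope.

(* The library norm `|u| on 'rV[R]_n is the sup norm, so every metric notion
   below uses [enorm]. Topological notions (continuity, differentiability) keep
   the library's structure: the two norms induce the same topology. *)
Definition dot (R : realType) (n : nat) (u v : 'rV[R]_n) : R :=
  \sum_(i < n) u ord0 i * v ord0 i.

Definition enorm (R : realType) (n : nat) (u : 'rV[R]_n) : R :=
  Num.sqrt (dot u u).

Definition elipschitz (R : realType) (n : nat) (k : R)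
    (f : 'rV[R]_n -> 'rV[R]_n) : Prop :=
  forall y z, enorm (f y - f z) <= k * enorm (y - z).

Definition contraction_mapping (R : realType) (n : nat)
    (S : 'rV[R]_n -> 'rV[R]_n) : Prop :=
  exists q : R, 0 <= q < 1 /\ elipschitz q S.

Definition grad (R : realType) (n : nat) (V : 'rV[R]_n -> R) (x : 'rV[R]_n) :
    'rV[R]_n :=
  \row_(i < n) 'D_(delta_mx ord0 i) V x.

Definition continuously_differentiable (R : realType) (n : nat)
    (V : 'rV[R]_n -> R) : Prop :=
  (forall x, differentiable V x) /\ continuous (grad V).

Definition L_smooth (R : realType) (n : nat) (L : R)
    (V : 'rV[R]_n -> R) : Prop :=
  [/\ 0 < L, continuously_differentiable V & elipschitz L (grad V)].

Definition mu_convex (R : realType) (n : nat) (mu : R)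
    (V : 'rV[R]_n -> R) : Prop :=
  0 <= mu /\
  convex_function (E := 'rV[R]_n) setT
    (fun x : 'rV[R]_n => V x - mu / 2 * enorm x ^+ 2).

Definition discrete_gradient (R : realType) (n : nat) (V : 'rV[R]_n -> R)
    (G : 'rV[R]_n -> 'rV[R]_n -> 'rV[R]_n) : Prop :=
  [/\ continuous (fun p : 'rV[R]_n * 'rV[R]_n => G p.1 p.2),
      forall x y, dot (G x y) (y - x) = V y - V x
    & forall x, G x x = grad V x].

(* A construction is encoded as a total function of V; its values at functions
   that are not continuously differentiable are junk and never constrained. *)
Definition discrete_gradient_construction (R : realType) (n : nat)
    (DG : ('rV[R]_n -> R) -> 'rV[R]_n -> 'rV[R]_n -> 'rV[R]_n) : Prop :=
  forall V, continuously_differentiable V -> discrete_gradient V (DG V).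

Definition smoothness_monotonicity (R : realType) (n : nat)
    (DG : ('rV[R]_n -> R) -> 'rV[R]_n -> 'rV[R]_n -> 'rV[R]_n)
    (cL cmu : R) : Prop :=
  [/\ 0 < cL, 0 < cmu,
      forall (V : 'rV[R]_n -> R) (L : R), L_smooth L V ->
        forall x, elipschitz (cL * L) (DG V x)
    & forall (V : 'rV[R]_n -> R) (mu : R),
        continuously_differentiable V -> mu_convex mu V ->
        forall x y z, dot (DG V x y - DG V x z) (y - z)
                      >= cmu * mu * enorm (y - z) ^+ 2].

Definition T_map (R : realType) (n : nat)
    (DG : ('rV[R]_n -> R) -> 'rV[R]_n -> 'rV[R]_n -> 'rV[R]_n)
    (V : 'rV[R]_n -> R) (x : 'rV[R]_n) (tau : R) (y : 'rV[R]_n) : 'rV[R]_n :=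
  x - tau *: DG V x y.

Definition S_map (R : realType) (n : nat)
    (DG : ('rV[R]_n -> R) -> 'rV[R]_n -> 'rV[R]_n -> 'rV[R]_n)
    (V : 'rV[R]_n -> R) (x : 'rV[R]_n) (theta tau : R) (y : 'rV[R]_n) :
    'rV[R]_n :=
  (1 - theta) *: y + theta *: T_map DG V x tau y.

(* Main.v *)
(** Write [w = y - z] and let [g] be the difference of the discrete gradients
    at [y] and [z]. Then [S y - S z = (1 - theta) w - theta tau g]; expanding
    the square and using [|g| <= LDG |w|] and [<g, w> >= m |w|^2] gives a squared
    Lipschitz constant
    [(1 - theta)^2 - 2 theta (1 - theta) tau m + theta^2 tau^2 LDG^2].
    In case (ii) monotonicity gives [m = muDG], and the constant is below [1]
    exactly under the stated bound on [theta]. In case (i) the Lipschitz bound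
    alone gives [m = - LDG], and the constant is
    [(1 - theta + theta tau LDG)^2]. *)
Require Import Defs.
From mathcomp Require Import all_boot all_order all_algebra.
From mathcomp Require Import all_classical all_reals all_analysis.
From mathcomp Require Import ring lra.

Import Order.TTheory GRing.Theory Num.Theory.
Import numFieldNormedType.Exports.

Local Open Scope ring_scope.

Lemma dot_ge0 (R : realType) (n : nat) (u : 'rV[R]_n) : 0 <= dot u u.
Proof. by apply: sumr_ge0 => i _; rewrite -expr2 sqr_ge0. Qed.

Lemma enorm_sqr (R : realType) (n : nat) (u : 'rV[R]_n) :
  enorm u ^+ 2 = dot u u.
Proof. by rewrite sqr_sqrtr ?dot_ge0. Qed.

Lemma enorm_ge0 (R : realType) (n : nat) (u : 'rV[R]_n) : 0 <= enorm u.
Proof. exact: sqrtr_ge0. Qed.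

Lemma dot_lincomb (R : realType) (n : nat) (a b : R) (u v : 'rV[R]_n) :
  dot (a *: u + b *: v) (a *: u + b *: v) =
  a ^+ 2 * dot u u + 2 * a * b * dot v u + b ^+ 2 * dot v v.
Proof.
rewrite /dot !mulr_sumr -!big_split /=; apply: eq_bigr => i _.
by rewrite !mxE; ring.
Qed.

Lemma dot_le_of_enorm_le (R : realType) (n : nat) (K : R) (u v : 'rV[R]_n) :
  enorm v <= K * enorm u -> dot v v <= K ^+ 2 * dot u u.
Proof.
move=> vu; rewrite -!enorm_sqr -exprMn.
by apply: lerXn2r => //; rewrite nnegrE ?enorm_ge0 // (le_trans _ vu) ?enorm_ge0.
Qed.

(* Expand [0 <= |v + K u|^2]; this avoids Cauchy-Schwarz. *)
Lemma dot_ge_of_enorm_le (R : realType) (n : nat) (K : R) (u v : 'rV[R]_n) :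
  0 < K -> enorm v <= K * enorm u -> - K * dot u u <= dot v u.
Proof.
move=> K0 /dot_le_of_enorm_le vu.
have := dot_ge0 _ _ (K *: u + 1 *: v); rewrite dot_lincomb => sq_ge0.
by rewrite -(ler_pM2l K0); nra.
Qed.

Definition relaxed_const {R : realType} (theta tau K m : R) : R :=
  (1 - theta) ^+ 2 - 2 * theta * (1 - theta) * tau * m +
  theta ^+ 2 * tau ^+ 2 * K ^+ 2.

(** The sign of [m] is left free so that both cases are instances: [m = - LDG] in (i), [m = muDG] in
    (ii). *)
Lemma relaxed_step_contraction (R : realType) (n : nat)
    (G : 'rV[R]_n -> 'rV[R]_n) (x : 'rV[R]_n) (theta tau K m : R) :
  0 <= theta <= 1 -> 0 <= tau -> elipschitz K G ->
  (forall y z, m * dot (y - z) (y - z) <= dot (G y - G z) (y - z)) ->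
  relaxed_const theta tau K m < 1 ->
  contraction_mapping (fun y => (1 - theta) *: y + theta *: (x - tau *: G y)).
Proof.
move=> /andP[theta0 theta1] tau0 GK Gm k1.
exists (Num.sqrt (relaxed_const theta tau K m)); split.
  by rewrite sqrtr_ge0 -[ltRHS]sqrtr1 ltr_sqrt.
move=> y z.
(* With the dot product as first factor, [sqrtrM] asks only for its nonnegativity, so the sign of
   [relaxed_const] need not be settled. *)
rewrite mulrC /enorm -sqrtrM ?dot_ge0 //; apply: ler_wsqrtr.
have -> : (1 - theta) *: y + theta *: (x - tau *: G y) -
          ((1 - theta) *: z + theta *: (x - tau *: G z)) =
          (1 - theta) *: (y - z) + (- (theta * tau)) *: (G y - G z).
  by apply/rowP => i; rewrite !mxE; ring.
rewrite dot_lincomb.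
have gg := dot_le_of_enorm_le _ _ _ _ _ (GK y z).
(* This factor multiplies the lower bound [Gm]; its sign is where [theta <= 1] enters. *)
have c0 : 0 <= 2 * theta * (1 - theta) * tau.
  by rewrite !mulr_ge0 // subr_ge0.
have := ler_wpM2l c0 (Gm y z).
have := ler_wpM2l (sqr_ge0 (theta * tau)) gg.
by rewrite /relaxed_const; lra.
Qed.

Theorem theorem4p5 (R : realType) (n : nat)
    (DG : ('rV[R]_n -> R) -> 'rV[R]_n -> 'rV[R]_n -> 'rV[R]_n)
    (cL cmu L mu : R) (V : 'rV[R]_n -> R) (x : 'rV[R]_n) (tau theta : R)
    (HDG : discrete_gradient_construction DG)
    (HSM : smoothness_monotonicity DG cL cmu)
    (HV : L_smooth L V)
    (Htau : 0 < tau) :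
  let LDG := cL * L in
  let muDG := cmu * mu in
  (tau < 1 / LDG /\ 0 < theta <= 1) \/
  (mu_convex mu V /\
   0 < theta < Num.min 1 ((2 + 2 * tau * muDG) /
                          (1 + tau ^+ 2 * LDG ^+ 2 + 2 * tau * muDG))) ->
  contraction_mapping (S_map DG V x theta tau).
Proof.
move=> LDG muDG.
have [cL0 cmu0 HL Hmu] := HSM; have [L0 VC1 _] := HV.
have LDG0 : 0 < LDG by rewrite mulr_gt0.
have GK : elipschitz LDG (DG V x) by exact: HL.
case=> [[tauL /andP[theta0 theta1]]|[Vmu]].
- have {}tauL : tau * LDG < 1 by rewrite -ltr_pdivlMr.
  apply: (@relaxed_step_contraction _ _ (DG V x) x _ _ LDG (- LDG)) => //.
  + by rewrite ltW.
  + exact: ltW.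
  + by move=> y z; apply: dot_ge_of_enorm_le.
  have -> : relaxed_const theta tau LDG (- LDG) =
            (1 - theta + theta * (tau * LDG)) ^+ 2.
    by rewrite /relaxed_const; ring.
  have t0 : 0 < theta * (tau * LDG) by rewrite !mulr_gt0.
  have t1 : theta * (tau * LDG) < theta by rewrite gtr_pMr.
  by rewrite expr_lt1 //; lra.
- rewrite lt_min => /and3P[theta0 theta1].
  (* Since [0 <= mu], the denominator in the bound on [theta] is at least 1 and can be cleared. *)
  have muDG0 : 0 <= muDG by rewrite mulr_ge0 ?(ltW cmu0) //; case: Vmu.
  have tm0 : 0 <= tau * muDG by rewrite mulr_ge0 // ltW.
  have tL0 : 0 <= tau ^+ 2 * LDG ^+ 2 by rewrite mulr_ge0 ?sqr_ge0.
  rewrite ltr_pdivlMr; last by lra.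
  move=> thetaB.
  apply: (@relaxed_step_contraction _ _ (DG V x) x _ _ LDG muDG) => //.
  + by rewrite !ltW.
  + exact: ltW.
  + by move=> y z; rewrite -enorm_sqr; apply: Hmu.
  (* The left side minus the right side is exactly [relaxed_const theta tau LDG muDG - 1]. *)
  have : theta * (theta * (1 + tau ^+ 2 * LDG ^+ 2 + 2 * tau * muDG)) <
         theta * (2 + 2 * tau * muDG) by rewrite ltr_pM2l.
  by rewrite /relaxed_const; lra.
Qed.
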